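(* Let $u$ and $v$ be nonadjacent (distinct) vertices of a graph $G$. Then $\gamma(G) \leq \gamma(G_{u,v,2}) \leq \gamma(G)+1$. Moreover: (C) $\gamma(G_{u,v,2}) = \gamma(G)$ if and only if at least one of the following holds: (i) there is a $\gamma$-set of $G$ which contains both $u$ and $v$; (ii) at least one of $u$ and $v$ is in $V^-(G)$. (D) $\gamma(G_{u,v,2}) = \gamma(G)+1$ if and only if $u,v \notin V^-(G)$ and any $\gamma$-set of $G$ contains at most one of $u$ and $v$.
   Context: Graphs are finite and simple. $\gamma(H)$ denotes the domination number of a graph $H$; a $\gamma$-set of $H$ is a dominating set of $H$ of cardinality $\gamma(H)$. $V^-(H) = \{x \in V(H) \mid \gamma(H-x) < \gamma(H)\}$. For distinct vertices $u,v$ of $G$, $G_{u,v,2}$ is the graph obtained from $G$ by adding two new vertices $x_1,x_2$ and the edges $ux_1$, $x_1x_2$, $x_2v$. *)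

(* Defs.v *)
From mathcomp Require Import all_boot.

Set Implicit Arguments.
Unset Strict Implicit.
Unset Printing Implicit Defensive.

Record sgraph := SGraph {
  vertex :> finType;
  adj : rel vertex;
  adj_sym : symmetric adj;
  adj_irrefl : irreflexive adj
}.

Definition dominating (G : sgraph) (D : {set G}) : bool :=
  [forall x : G, (x \in D) || [exists y in D, adj x y]].

(* The default [set: G] of the arg min is always dominating, so the minimum
   is genuine (see dom_numP). *)
Definition dom_num (G : sgraph) : nat :=
  #|[arg min_(D < [set: G] | dominating D) #|D| ]|.

Definition gamma_set (G : sgraph) (D : {set G}) : bool :=
  dominating D && (#|D| == dom_num G).

Lemma dominatingT (G : sgraph) : dominating [set: G].
Proof. by apply/forallP => x; rewrite inE. Qed.

Lemma dom_numP (G : sgraph) :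
  (exists D : {set G}, gamma_set D) /\
  (forall D : {set G}, dominating D -> dom_num G <= #|D|).
Proof.
rewrite /gamma_set /dom_num; case: arg_minnP; first exact: dominatingT.
by move=> D domD minD; split=> //; exists D; rewrite domD eqxx.
Qed.

Section DeleteVertex.
Variables (G : sgraph) (x : G).

Definition del_adj : rel {y : G | y != x} :=
  fun a b => adj (val a) (val b).

Lemma del_adj_sym : symmetric del_adj.
Proof. by move=> a b; exact: adj_sym. Qed.

Lemma del_adj_irrefl : irreflexive del_adj.
Proof. by move=> a; exact: adj_irrefl. Qed.

Definition del_vertex : sgraph := SGraph del_adj_sym del_adj_irrefl.

End DeleteVertex.

Definition Vminus (G : sgraph) : {set G} :=
  [set x : G | dom_num (del_vertex x) < dom_num G].

Section AddPath2.
Variables (G : sgraph) (u v : G).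

(* The new vertices are x_1 = inr false and x_2 = inr true. *)
Definition path2_adj : rel (G + bool) := fun a b =>
  match a, b with
  | inl y, inl z => adj y z
  | inl y, inr i | inr i, inl y => y == (if i then v else u)
  | inr i, inr j => i != j
  end.

Lemma path2_adj_sym : symmetric path2_adj.
Proof. by move=> [y|i] [z|j] //=; [exact: adj_sym | rewrite eq_sym]. Qed.

Lemma path2_adj_irrefl : irreflexive path2_adj.
Proof. by move=> [y|i] /=; [exact: adj_irrefl | rewrite eqxx]. Qed.

Definition add_path2 : sgraph := SGraph path2_adj_sym path2_adj_irrefl.

End AddPath2.

(* Main.v *)
Require Import Defs.
From mathcomp Require Import all_boot.

(** A set of vertices of [add_path2 u v] splits as [D] in [G] and [B] among the
    new vertices.  The new vertices in [B] reach only their attached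
    endpoints, so [D] together with these endpoints dominates [G]; this gives
    the lower bound.  In case of equality, [B] empty forces [u, v \in D], [B]
    full makes [D :|: [set u; v]] a minimum dominating set, and [B] a singleton
    leaves [D] of size [dom_num G - 1] dominating all of [G] but one endpoint,
    which is thus in [Vminus G].  Conversely each of these configurations
    extends to a dominating set of [add_path2 u v]. *)

(** The body of [dominating] at a single vertex, so that domination of all vertices but one can be
    expressed. *)
Definition dominates (G : sgraph) (D : {set G}) (x : G) : bool :=
  (x \in D) || [exists y in D, adj x y].

Lemma dominatingP (G : sgraph) (D : {set G}) :
  reflect (forall x, dominates G D x) (dominating D).
Proof. exact: forallP. Qed.

Lemma dominatesP (G : sgraph) (D : {set G}) (x : G) :
  reflect (x \in D \/ exists2 y, y \in D & adj x y) (dominates G D x).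
Proof.
apply: (iffP orP) => -[xD|]; [by left| |by left|].
  by case/exists_inP=> y yD xy; right; exists y.
by case=> y yD xy; right; apply/exists_inP; exists y.
Qed.

Lemma dominatesS (G : sgraph) (D E : {set G}) (x : G) :
  D \subset E -> dominates G D x -> dominates G E x.
Proof.
move=> /subsetP DE /dominatesP xD; apply/dominatesP.
by case: xD => [/DE|[y /DE yE xy]]; [left | right; exists y].
Qed.

Lemma dom_num_le (G : sgraph) (D : {set G}) :
  dominating D -> dom_num G <= #|D|.
Proof. by case: (dom_numP G) => _; apply. Qed.

(** Minimum dominating sets of [del_vertex x] embed into [G] along [val]. Conversely, [D] is too
    small to dominate [G], hence avoids [x] and restricts to [del_vertex x]. This form keeps the
    subtype out of the later arguments. *)
Lemma VminusP (G : sgraph) (x : G) :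
  reflect (exists2 D : {set G}, #|D| < dom_num G &
             forall y, y != x -> dominates G D y)
          (x \in Vminus G).
Proof.
rewrite inE; apply: (iffP idP) => [lt_x | [D ltD domD]].
  have [[D /andP[/dominatingP domD /eqP cardD]] _] := dom_numP (del_vertex x).
  exists [set val y | y in D].
    by rewrite card_imset ?cardD //; exact: val_inj.
  move=> y yx; apply/dominatesP.
  have /dominatesP[yD|[z zD yz]] := domD (Sub y yx).
    by left; apply/imsetP; exists (Sub y yx).
  by right; exists (val z) => //; exact: imset_f.
(* If [x] were in [D], then [D] would dominate [x] as well, hence all of [G], with fewer than
   [dom_num G] vertices. *)
have xND : x \notin D.
  apply: contraL ltD => xD; rewrite -leqNgt; apply: dom_num_le.
  apply/dominatingP => y; have [->|/domD //] := eqVneq y x.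
  by apply/dominatesP; left.
pose E : {set del_vertex x} := [set y | val y \in D].
have imE : [set val y | y in E] \subset D.
  by apply/subsetP => _ /imsetP[y yE ->]; rewrite inE in yE.
apply: leq_ltn_trans ltD; apply: leq_trans (subset_leq_card imE).
rewrite card_imset; last exact: val_inj.
apply/dom_num_le/dominatingP => y; apply/dominatesP.
have /dominatesP[yD|[z zD yz]] := domD _ (valP y); first by left; rewrite inE.
have zx : z != x by apply: contraNneq xND => <-.
by right; exists (Sub z zx); rewrite ?inE.
Qed.

(** The only neighbour in [G] of the new vertex [inr i]; the conditional is the one in
    [path2_adj]. *)
Definition path2_end (G : sgraph) (u v : G) (i : bool) : G :=
  if i then v else u.

Definition path2_set (G : sgraph) (u v : G) (D : {set G}) (B : {set bool}) :
    {set add_path2 u v} :=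
  [set a : G + bool | match a with inl x => x \in D | inr i => i \in B end].

Lemma card_path2_set (G : sgraph) (u v : G) (D : {set G}) (B : {set bool}) :
  #|path2_set G u v D B| = #|D| + #|B|.
Proof.
rewrite -!sum1_card big_sumType /=.
by congr (_ + _); apply: eq_bigl => x; rewrite inE.
Qed.

Lemma path2_setP (G : sgraph) (u v : G) (E : {set add_path2 u v}) :
  exists D B, E = path2_set G u v D B.
Proof.
exists [set x | inl x \in E], [set i | inr i \in E].
by apply/setP => -[x|i]; rewrite !inE.
Qed.

(** The new vertices are adjacent, so either one in [B] dominates both. Only when [B] is empty must
    they be dominated from [G], which forces both endpoints into [D]. *)
Lemma dominating_path2_setP (G : sgraph) (u v : G) (D : {set G})
    (B : {set bool}) :
  reflect ((forall x, dominates G D x \/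
              exists2 i, i \in B & x = path2_end G u v i) /\
           (B = set0 -> u \in D /\ v \in D))
          (dominating (path2_set G u v D B)).
Proof.
apply: (iffP (dominatingP _ _)) => [dom | [domD domB] [x|i]].
- split=> [x | B0].
    have /dominatesP[|[[y|i]]] := dom (inl x); rewrite !inE.
    + by left; apply/dominatesP; left.
    + by left; apply/dominatesP; right; exists y.
    + by move=> iB /eqP xE; right; exists i.
  suff endD i : path2_end G u v i \in D.
    by split; [exact: endD false | exact: endD true].
  have /dominatesP[|[[y|j]]] := dom (inr i); rewrite !inE ?B0 ?inE //.
  by move=> yD /eqP yE; rewrite /path2_end -yE.
- apply/dominatesP; case: (domD x) => [/dominatesP[xD|[y yD xy]]|[i iB ->]].
  + by left; rewrite inE.
  + by right; exists (inl y); rewrite ?inE.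
  + by right; exists (inr i); rewrite ?inE /=.
- apply/dominatesP; have [B0|[j jB]] := set_0Vmem B.
    right; exists (inl (path2_end G u v i)); rewrite ?inE //=.
    by case: (domB B0); case: i.
  have [ij|ij] := eqVneq i j; first by left; rewrite inE ij.
  by right; exists (inr j); rewrite ?inE.
Qed.

Lemma dominating_setU_path2_end (G : sgraph) (u v : G) (D : {set G})
    (B : {set bool}) :
  dominating (path2_set G u v D B) ->
  dominating (D :|: [set path2_end G u v i | i in B]).
Proof.
case/dominating_path2_setP => domD _; apply/dominatingP => x.
case: (domD x) => [|[i iB ->]]; first exact/dominatesS/subsetUl.
by apply/dominatesP; left; rewrite inE imset_f ?orbT.
Qed.

Lemma card_setU_path2_end (G : sgraph) (u v : G) (D : {set G})
    (B : {set bool}) :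
  #|D :|: [set path2_end G u v i | i in B]| <= #|D| + #|B|.
Proof.
by rewrite (leq_trans (leq_card_setU _ _)) // leq_add2l leq_imset_card.
Qed.

Lemma dom_num_add_path2_ge (G : sgraph) (u v : G) :
  dom_num G <= dom_num (add_path2 u v).
Proof.
have [[E /andP[domE /eqP <-]] _] := dom_numP (add_path2 u v).
have [D [B defE]] := path2_setP G u v E; rewrite {}defE in domE *.
rewrite card_path2_set; apply: leq_trans (card_setU_path2_end G u v D B).
exact/dom_num_le/dominating_setU_path2_end.
Qed.

Lemma dom_num_add_path2_le (G : sgraph) (u v : G) :
  dom_num (add_path2 u v) <= dom_num G + 1.
Proof.
have [[D /andP[/dominatingP domD /eqP <-]] _] := dom_numP G.
(* A minimum dominating set of [G] plus one new vertex suffices; the choice of [true] is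
   arbitrary. *)
rewrite -(cards1 true) -(card_path2_set G u v); apply: dom_num_le.
apply/dominating_path2_setP; split=> [x | /setP/(_ true)]; first by left.
by rewrite !inE.
Qed.

(** A set of size below [dom_num G] that may miss only endpoint [i] is completed by [inr i], which
    dominates that endpoint and both new vertices. *)
Lemma dom_num_add_path2_Vminus (G : sgraph) (u v : G) (i : bool) :
  path2_end G u v i \in Vminus G -> dom_num (add_path2 u v) <= dom_num G.
Proof.
case/VminusP => D ltD domD; apply: leq_trans ltD.
rewrite -addn1 -(cards1 i) -(card_path2_set G u v); apply: dom_num_le.
apply/dominating_path2_setP; split=> [x | /setP/(_ i)].
  have [->|/domD] := eqVneq x (path2_end G u v i); last by left.
  by right; exists i; rewrite ?inE.
by rewrite !inE eqxx.
Qed.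

Lemma dom_num_add_path2_gamma_set (G : sgraph) (u v : G) (D : {set G}) :
  gamma_set D -> u \in D -> v \in D ->
  dom_num (add_path2 u v) <= dom_num G.
Proof.
case/andP=> /dominatingP domD /eqP <- uD vD.
rewrite -[#|D|]addn0 -(cards0 bool) -(card_path2_set G u v); apply: dom_num_le.
by apply/dominating_path2_setP; split=> // x; left.
Qed.

Lemma dom_num_add_path2_eq (G : sgraph) (u v : G) :
  dom_num (add_path2 u v) = dom_num G <->
    (exists D : {set G}, [/\ gamma_set D, u \in D & v \in D]) \/
    (u \in Vminus G \/ v \in Vminus G).
Proof.
split=> [eqG | cfg]; last first.
  apply/eqP; rewrite eqn_leq dom_num_add_path2_ge andbT.
  case: cfg => [[D []] | [uV|vV]]; first exact: dom_num_add_path2_gamma_set.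
    exact: (dom_num_add_path2_Vminus G u v false).
  exact: (dom_num_add_path2_Vminus G u v true).
have [[E /andP[domE /eqP cardE]] _] := dom_numP (add_path2 u v).
have [D [B defE]] := path2_setP G u v E; rewrite {E}defE in domE cardE.
rewrite eqG card_path2_set in cardE.
(* This union dominates [G] and has at most [#|D| + #|B| = dom_num G] elements, so it is a minimum
   dominating set. *)
have gammaU :
    gamma_set (D :|: [set path2_end G u v i | i in B]).
  have domU := dominating_setU_path2_end _ _ _ _ _ domE.
  by rewrite /gamma_set domU eqn_leq dom_num_le // -cardE card_setU_path2_end.
have /dominating_path2_setP[domD domB] := domE.
case: (ltngtP #|B| 1) => [B0 | B2 | /eqP/cards1P[i defB]].
- have {}B0 : B = set0 by apply/eqP; rewrite -cards_eq0 -leqn0.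
  have [uD vD] := domB B0.
  by left; exists D; rewrite B0 imset0 setU0 in gammaU.
- have BT : B = setT by apply/eqP; rewrite eqEcard subsetT cardsT card_bool.
  left; exists (D :|: [set path2_end G u v i | i in B]); split=> //.
    by rewrite inE (imset_f (path2_end G u v) (x := false)) ?orbT ?BT ?inE.
  by rewrite inE (imset_f (path2_end G u v) (x := true)) ?orbT ?BT ?inE.
- have endV : path2_end G u v i \in Vminus G.
    apply/VminusP; exists D; first by rewrite -cardE defB cards1 addn1.
    (* A vertex not dominated by [D] must be the endpoint of the sole element [i] of [B]. *)
    move=> y yi; case: (domD y) => // -[j]; rewrite defB inE => /eqP -> yE.
    by rewrite yE eqxx in yi.
  by right; case: (i) endV => /= endV; [right | left].
Qed.

Theorem theorem14 (G : sgraph) (u v : G) (uDv : u != v)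
    (nuv : ~~ adj u v) :
  [/\ dom_num G <= dom_num (add_path2 u v) <= dom_num G + 1,
      dom_num (add_path2 u v) = dom_num G <->
        (exists D : {set G}, [/\ gamma_set D, u \in D & v \in D]) \/
        (u \in Vminus G \/ v \in Vminus G)
    & dom_num (add_path2 u v) = dom_num G + 1 <->
        [/\ u \notin Vminus G, v \notin Vminus G
          & forall D : {set G}, gamma_set D -> ~ (u \in D /\ v \in D)]].
Proof.
have ge := dom_num_add_path2_ge G u v; have le := dom_num_add_path2_le G u v.
have eqG := dom_num_add_path2_eq G u v.
(* The bounds leave only two values, so (D) follows by negating both sides of (C). *)
split; [by rewrite ge | by [] | split=> [gtG | [uV vV noD]]].
  have neq : dom_num (add_path2 u v) <> dom_num G.
    by rewrite gtG addn1 => /esym/n_Sn.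
  split; [| |move=> D gD [uD vD]]; last by apply/neq/eqG; left; exists D.
    by apply/negP => uV; apply/neq/eqG; right; left.
  by apply/negP => vV; apply/neq/eqG; right; right.
move: ge; rewrite leq_eqVlt => /orP[/eqP/esym/eqG cfg | gt]; last first.
  by apply/anti_leq; rewrite le addn1.
case: cfg => [[D [gD uD vD]] | [uV' | vV']]; first by case: (noD D).
  by rewrite uV' in uV.
by rewrite vV' in vV.
Qed.
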